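(* For every precubical set $B$ there exists a stream covering $\rho: E\rightarrow \vec{|B|}$ such that the preorder $\leqslant_E$ on $E$ is antisymmetric (i.e. a partial order).
   Context: A circulation on a topological space $X$ is a function assigning to each open $V\subset X$ a preorder $\leqslant_V$ on $V$ such that for every collection $\mathcal{O}$ of open subsets of $X$, $\leqslant_{\bigcup\mathcal{O}}$ is the preorder on $\bigcup\mathcal{O}$ with smallest graph containing $\bigcup_{V\in\mathcal{O}}\mathrm{graph}(\leqslant_V)$. A stream is a space with a circulation; $\leqslant_X$ denotes the preorder assigned to $X$ itself. A stream map $f:X\to Y$ is a continuous map with $f(x)\leqslant_V f(y)$ whenever $x\leqslant_{f^{-1}V}y$, for every open $V\subset Y$. The forgetful functor $U$ from streams to spaces is topological; in particular the category of streams is complete and cocomplete, with limits and colimits computed on underlying spaces (colimits carry the final circulation). An open substream of $X$ is an open $V\subset X$ with the circulation $W\mapsto \leqslant_W$ for open $W\subset V$. A stream covering is a surjective stream map $\rho:E\to B$ such that $B$ is covered by open substreams whose preimages under $\rho$ are disjoint unions of open substreams on each of which $\rho$ restricts to an isomorphism of streams onto the corresponding open substream of $B$. Precubical sets: let $[0]=\{0\}$, $[1]=\{0<1\}$, and let $\square$ be the smallest subcategory of the category of posets and monotone maps that is closed under cartesian products (with unit $[0]$) and contains $\delta_-,\delta_+:[0]\to[1]$ (sending $0$ to $0$, resp. $1$); its objects are the $[1]^n$. A precubical set is a functor $X:\square^{op}\to\mathbf{Set}$; write $X_n=X([1]^n)$. Let $\vec{\square}[1]$ be the unit interval $\mathbb{I}=[0,1]$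 with circulation: for open $V\subset\mathbb{I}$, $x\leqslant_V y$ iff $x\le y$ and $[x,y]\subset V$. Let $\vec{\square}[n]$ be the $n$-fold product of $\vec{\square}[1]$ in streams (underlying space $\mathbb{I}^n$); each $\square$-morphism $[1]^m\to[1]^n$ extends linearly to a stream map $\vec\square[m]\to\vec\square[n]$, giving a functor $\vec\square$ from $\square$ to streams. The stream realization of $X$ is the coend $\vec{|X|}=\int^{[1]^n\in\square} X_n\cdot\vec{\square}[n]$ in the category of streams; its underlying space is the usual geometric realization $|X|$ (a CW complex with one $n$-cell for each element of $X_n$). *)

(* Defs.v *)
From mathcomp Require Import ssreflect ssrfun ssrbool eqtype ssrnat seq choice fintype finfun.
From Stdlib Require Import Reals Relations.

Unset Implicit Arguments.
Unset Strict Implicit.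

(* Raw streams: a type with a family of "open" predicates and, for each
   predicate V, a relation le V (meaningful for open V).               *)
Record Stream := MkStream {
  car :> Type;
  op : (car -> Prop) -> Prop;
  le : (car -> Prop) -> car -> car -> Prop }.
Arguments op {s} _.
Arguments le {s} _ _ _.

Definition is_topology (T : Type) (op : (T -> Prop) -> Prop) : Prop :=
  op (fun _ => True) /\
  (forall O : (T -> Prop) -> Prop, (forall V, O V -> op V) ->
      op (fun x => exists V, O V /\ V x)) /\
  (forall U V, op U -> op V -> op (fun x => U x /\ V x)).
Arguments is_topology {T} _.

(* A circulation: each open V gets a preorder on V, and for every
   collection O of opens, le (union O) is the smallest preorder on
   union O containing all graphs le V (V in O), i.e. the transitive
   closure of their union (reflexivity on union O is already present). *)
Definition is_circulation (T : Type) (op : (T -> Prop) -> Prop)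
    (le : (T -> Prop) -> T -> T -> Prop) : Prop :=
  (forall V, op V ->
     (forall x y, le V x y -> V x /\ V y) /\
     (forall x, V x -> le V x x) /\
     (forall x y z, le V x y -> le V y z -> le V x z)) /\
  (forall (O : (T -> Prop) -> Prop) (U : T -> Prop),
     (forall V, O V -> op V) ->
     (forall x, U x <-> exists V, O V /\ V x) ->
     forall x y, le U x y <->
       clos_trans T (fun a b => exists V, O V /\ le V a b) x y).
Arguments is_circulation {T} _ _.

Definition is_stream (X : Stream) : Prop :=
  is_topology (@op X) /\ is_circulation (@op X) (@le X).

Definition le_full (X : Stream) : X -> X -> Prop := le (fun _ => True).
Arguments le_full {X} _ _.

Definition continuous (X Y : Stream) (f : X -> Y) : Prop :=
  forall V, op V -> op (fun x => V (f x)).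
Arguments continuous {X Y} _.

Definition stream_map (X Y : Stream) (f : X -> Y) : Prop :=
  continuous f /\
  forall V, op V -> forall x y, le (fun z => V (f z)) x y -> le V (f x) (f y).
Arguments stream_map {X Y} _.

Definition stream_iso (X Y : Stream) (f : X -> Y) : Prop :=
  stream_map f /\
  exists g : Y -> X, stream_map g /\ (forall x, g (f x) = x) /\ (forall y, f (g y) = y).
Arguments stream_iso {X Y} _.

(* Open substream on an open V of X: carrier {x | V x}; its opens are the
   opens W of X contained in V, with the circulation W |-> le_W of X. *)
Definition sub_img (X : Stream) (V : X -> Prop) (W : {x | V x} -> Prop) : X -> Prop :=
  fun x => exists h : V x, W (exist _ x h).
Arguments sub_img {X V} _ _.

Definition substream (X : Stream) (V : X -> Prop) : Stream :=
  {| car := {x | V x};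
     op := fun W => op (sub_img W);
     le := fun W a b => le (sub_img W) (proj1_sig a) (proj1_sig b) |}.
Arguments substream {X} _.

Definition stream_covering (E B : Stream) (rho : E -> B) : Prop :=
  stream_map rho /\
  (forall b, exists e, rho e = b) /\
  forall b : B, exists V : B -> Prop, op V /\ V b /\
    exists (I : Type) (U : I -> E -> Prop),
      (forall i, op (U i)) /\
      (forall i j x, U i x -> U j x -> i = j) /\
      (forall x, V (rho x) <-> exists i, U i x) /\
      forall i, exists r : substream (U i) -> substream V,
        (forall x, proj1_sig (r x) = rho (proj1_sig x)) /\ stream_iso r.
Arguments stream_covering {E B} _.

Definition is_stream_product (P : Stream) (J : Type) (Y : J -> Stream)
    (p : forall j, P -> Y j) : Prop :=
  is_stream P /\ (forall j, stream_map (p j)) /\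
  forall Z : Stream, is_stream Z ->
  forall g : forall j, Z -> Y j, (forall j, stream_map (g j)) ->
  exists h : Z -> P, stream_map h /\ (forall j z, p j (h z) = g j z) /\
    forall h' : Z -> P, stream_map h' -> (forall j z, p j (h' z) = g j z) ->
      forall z, h' z = h z.

Open Scope R_scope.

Definition Icar : Type := {r : R | 0 <= r <= 1}.

Definition dI : Stream :=
  {| car := Icar;
     op := fun V => forall x : Icar, V x -> exists eps, 0 < eps /\
             forall y : Icar, Rabs (proj1_sig y - proj1_sig x) < eps -> V y;
     le := fun V x y => proj1_sig x <= proj1_sig y /\
             forall z : Icar, proj1_sig x <= proj1_sig z <= proj1_sig y -> V z |}.

Definition cube_car (n : nat) : Type := {t : 'I_n -> R | forall i, 0 <= t i <= 1}.

Definition cube_open (n : nat) (V : cube_car n -> Prop) : Prop :=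
  forall x, V x -> exists eps, 0 < eps /\
    forall y : cube_car n, (forall i, Rabs (proj1_sig y i - proj1_sig x i) < eps) -> V y.

Definition cube (n : nat) (C : (cube_car n -> Prop) -> cube_car n -> cube_car n -> Prop)
  : Stream := {| car := cube_car n; op := @cube_open n; le := C |}.

Definition cube_proj (n : nat) (C : (cube_car n -> Prop) -> cube_car n -> cube_car n -> Prop) (i : 'I_n) (t : cube n C) : dI :=
  exist (fun r => 0 <= r <= 1) (proj1_sig t i) (proj2_sig t i).

Definition is_cube_circ (n : nat) (C : (cube_car n -> Prop) -> cube_car n -> cube_car n -> Prop) : Prop :=
  is_stream_product (cube n C) 'I_n (fun _ : 'I_n => dI) (@cube_proj n C).

(* The box category: smallest subcategory of posets closed under cartesian
   products (the product [1]^a x [1]^b being identified with [1]^(a+b) by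
   concatenation of coordinates) and containing delta_-, delta_+.
   A point of [1]^n is a function 'I_n -> bool (false = 0, true = 1).  *)
Definition prod_map (a b c d : nat) (f : ('I_a -> bool) -> ('I_b -> bool))
    (g : ('I_c -> bool) -> ('I_d -> bool)) :
    ('I_(a + c) -> bool) -> ('I_(b + d) -> bool) :=
  fun x j => match fintype.split j with
             | inl j1 => f (fun k => x (lshift c k)) j1
             | inr j2 => g (fun k => x (rshift a k)) j2
             end.

Inductive box_mor : forall m n : nat, (('I_m -> bool) -> ('I_n -> bool)) -> Prop :=
  | box_id n :  box_mor _ _ (fun x : 'I_n -> bool => x)
  | box_dminus :  box_mor _ _ (fun (_ : 'I_0 -> bool) (_ : 'I_1) => false)
  | box_dplus :  box_mor _ _ (fun (_ : 'I_0 -> bool) (_ : 'I_1) => true)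
  | box_comp l m n (f : ('I_l -> bool) -> ('I_m -> bool)) (g : ('I_m -> bool) -> ('I_n -> bool)) :
      box_mor _ _ f -> box_mor _ _ g ->  box_mor _ _ (fun x => g (f x))
  | box_prod a b c d (f : ('I_a -> bool) -> ('I_b -> bool)) (g : ('I_c -> bool) -> ('I_d -> bool)) :
      box_mor _ _ f -> box_mor _ _ g ->  box_mor _ _ (prod_map a b c d f g)
  | box_ext m n (f g : ('I_m -> bool) -> ('I_n -> bool)) :
      box_mor _ _ f -> (forall x, f x = g x) -> box_mor _ _ g.
Arguments box_mor {m n} _.

Record PCSet := MkPCSet {
  cell : nat -> Type;
  act : forall m n (f : ('I_m -> bool) -> ('I_n -> bool)), box_mor f -> cell n -> cell m }.
Arguments act p {m n f} _ _.

Definition is_precubical (X : PCSet) : Prop :=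
  (forall m n (f g : ('I_m -> bool) -> ('I_n -> bool)) (Hf : box_mor f) (Hg : box_mor g),
     (forall y, f y = g y) -> forall x, act X Hf x = act X Hg x) /\
  (forall n (H : box_mor (fun x : 'I_n -> bool => x)) x, act X H x = x) /\
  (forall l m n (f : ('I_l -> bool) -> ('I_m -> bool)) (g : ('I_m -> bool) -> ('I_n -> bool))
     (Hf : box_mor f) (Hg : box_mor g) (Hgf : box_mor (fun x => g (f x))) x,
     act X Hgf x = act X Hf (act X Hg x)).

(* Linear (multilinear) extension of f : [1]^m -> [1]^n to I^m -> I^n. *)
Definition vert_weight (m : nat) (x : {ffun 'I_m -> bool}) (t : 'I_m -> R) : R :=
  foldr Rmult 1 (map (fun k => if x k then t k else 1 - t k) (enum 'I_m)).

Definition lin_ext (m n : nat) (f : ('I_m -> bool) -> ('I_n -> bool))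
    (t : 'I_m -> R) (j : 'I_n) : R :=
  foldr Rplus 0 (map (fun x : {ffun 'I_m -> bool} =>
                        (if f x j then 1 else 0) * vert_weight m x t)
                     (enum {ffun 'I_m -> bool})).
Arguments lin_ext {m n} _ _ _.

(* R, with the maps iota n x : \vec\square[n] -> R (x in B_n), is the stream
   realization of B: the coend  \int^n B_n . \vec\square[n]  in streams. *)
Definition is_stream_realization (B : PCSet) (R : Stream)
    (C : forall n, (cube_car n -> Prop) -> cube_car n -> cube_car n -> Prop)
    (iota : forall n, cell B n -> cube n (C n) -> R) : Prop :=
  (forall n, is_cube_circ n (C n)) /\
  is_stream R /\
  (forall n x, stream_map (iota n x)) /\
  (forall m n f (H : box_mor f) (x : cell B n) (t : cube m (C m)) (u : cube n (C n)),
     (forall j, proj1_sig u j = lin_ext f (proj1_sig t) j) ->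
     iota m (act _ H x) t = iota n x u) /\
  forall Z : Stream, is_stream Z ->
  forall g : forall n, cell B n -> cube n (C n) -> Z,
    (forall n x, stream_map (g n x)) ->
    (forall m n f (H : box_mor f) (x : cell B n) (t : cube m (C m)) (u : cube n (C n)),
       (forall j, proj1_sig u j = lin_ext f (proj1_sig t) j) ->
       g m (act _ H x) t = g n x u) ->
    exists h : R -> Z, stream_map h /\ (forall n x t, h (iota n x t) = g n x t) /\
      forall h' : R -> Z, stream_map h' -> (forall n x t, h' (iota n x t) = g n x t) ->
        forall r, h' r = h r.

Close Scope R_scope.

(* Main.v *)
(** Adding up coordinates sends a point [t] of a cube of [B] to a real number
    that is well defined modulo 1 on the realization, because a face inclusion
    only inserts coordinates 0 and 1.  The covering [E] is the pullback along
    this map of the universal cover of the circle.  A directed step inside a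
    cube strictly increases the coordinate sum unless it is constant, and the
    order of the realization is generated by such steps; hence the lifted sum
    [E -> R] is strictly increasing, and [<=_E] is antisymmetric. *)

From HB Require Import structures.
From mathcomp Require Import ssreflect ssrfun ssrbool eqtype ssrnat seq fintype finfun bigop.
From Stdlib Require Import Reals Relations Lra Lia ClassicalEpsilon.
From Stdlib Require Import FunctionalExtensionality PropExtensionality ProofIrrelevance.
Require Import Defs.

Set Implicit Arguments.
Unset Strict Implicit.

(** * Extensionality and transitive closures *)

Lemma pred_ext (T : Type) (P Q : T -> Prop) : (forall x, P x <-> Q x) -> P = Q.
Proof.
move=> PQ; apply: functional_extensionality => x.
exact: propositional_extensionality.
Qed.

Lemma sig_ext (T : Type) (P : T -> Prop) (x y : {z | P z}) :
  proj1_sig x = proj1_sig y -> x = y.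
Proof.
case: x y => [x Px] [y Py] /= xy; move: Px Py; rewrite xy => Px Py.
by rewrite (proof_irrelevance _ Px Py).
Qed.

Lemma clos_trans_map (A A' : Type) (r : relation A) (r' : relation A')
    (f : A -> A') :
  (forall a b, r a b -> clos_trans A' r' (f a) (f b)) ->
  forall a b, clos_trans A r a b -> clos_trans A' r' (f a) (f b).
Proof.
move=> rr' a b; elim=> [x y|x y z _ IH1 _ IH2]; first exact: rr'.
exact: t_trans IH1 IH2.
Qed.

Lemma clos_trans_sub (A : Type) (r r' : relation A) :
  (forall a b, r a b -> clos_trans A r' a b) ->
  forall a b, clos_trans A r a b -> clos_trans A r' a b.
Proof. exact (@clos_trans_map A A r r' (fun a => a)). Qed.

(** * Streams *)

Lemma le_mem (X : Stream) (V : X -> Prop) (x y : X) :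
  is_stream X -> op V -> le V x y -> V x /\ V y.
Proof. by move=> [_ [pre _]] oV; case: (pre V oV) => mem _; exact: mem. Qed.

Lemma le_refl (X : Stream) (V : X -> Prop) (x : X) :
  is_stream X -> op V -> V x -> le V x x.
Proof. by move=> [_ [pre _]] oV; case: (pre V oV) => _ [rfl _]; exact: rfl. Qed.

Lemma le_trans (X : Stream) (V : X -> Prop) (x y z : X) :
  is_stream X -> op V -> le V x y -> le V y z -> le V x z.
Proof. by move=> [_ [pre _]] oV; case: (pre V oV) => _ [_ tr]; exact: tr. Qed.

(** The circulation axiom for the cover of [U] by the two members [V] and [U]. *)
Lemma le_mono (X : Stream) (V U : X -> Prop) (x y : X) :
  is_stream X -> op V -> op U -> (forall z, V z -> U z) -> le V x y -> le U x y.
Proof.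
move=> [_ [_ cov]] oV oU VU lexy.
apply/(cov (fun W => W = V \/ W = U)).
- by move=> W [->|->].
- move=> z; split=> [Uz|[W [[->|->]]]] //; last exact: VU.
  by exists U; split; [right|].
- by apply: t_step; exists V; split; [left|].
Qed.

(** Any function from a stream into it is a stream map, so a universal property tested against it
    produces a mere function of sets. *)
Definition indiscrete_stream (T : Type) : Stream :=
  {| car := T;
     op := fun V => (forall x, V x) \/ (forall x, ~ V x);
     le := fun V x y => V x /\ V y |}.

Lemma indiscrete_is_stream (T : Type) : is_stream (indiscrete_stream T).
Proof.
split; [split; [by left|split]|split].
- move=> O OV; case: (classic (exists V, O V /\ forall x, V x)) => [[V [OV' fV]]|nfull].
    by left=> x; exists V.
  right=> x [V [OV' Vx]]; case: (OV V OV') => [fV|eV]; last exact: (eV x).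
  by apply: nfull; exists V.
- move=> U V [fU|eU] [fV|eV]; first by left=> x; split.
  + by right=> x [_ /eV].
  + by right=> x [/eU].
  + by right=> x [/eU].
- by move=> V _ /=; split; [|split] => //; move=> x y z [? ?] [? ?].
- move=> O U OV covU x y; split=> /=.
    move=> [/covU [V [OV' Vx]] _]; apply: t_step; exists V; split=> //.
    by case: (OV V OV') => [fV|/(_ x)].
  elim=> [a b [V [OV' [Va Vb]]]|a b c _ [Ua _] _ [_ Uc]] //.
  by split; apply/covU; exists V.
Qed.

(** * Gluing a covering stream from sheets *)

Section Sheets.

Variables (X : Stream) (E I : Type) (rho : E -> X) (S : I -> E -> Prop).
Hypothesis streamX : is_stream X.
Hypothesis rho_inj : forall i e e', S i e -> S i e' -> rho e = rho e' -> e = e'.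
Hypothesis sheet_cover : forall e, exists i, S i e.

Definition img (W : E -> Prop) : X -> Prop := fun x => exists e, W e /\ rho e = x.

Definition on_sheet (W : E -> Prop) (i : I) : E -> Prop := fun e => W e /\ S i e.

(** Compatibility of charts: it makes every sheet open in the glued stream, and the case [i = j]
    makes the image of a sheet open. *)
Hypothesis sheet_overlap : forall i j, op (img (on_sheet (S i) j)).

Definition sheet_link (W : E -> Prop) (a b : E) : Prop :=
  exists i, [/\ on_sheet W i a, on_sheet W i b &
                le (img (on_sheet W i)) (rho a) (rho b)].

(** The final structure for the local inverses of [rho] on the sheets: openness is tested on the
    image of each sheet, and the order is generated by steps inside one sheet. *)
Definition sheet_stream : Stream :=
  {| car := E;
     op := fun W => forall i, op (img (on_sheet W i));
     le := fun W => clos_trans E (sheet_link W) |}.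

Lemma img_mono (W W' : E -> Prop) :
  (forall e, W e -> W' e) -> forall x, img W x -> img W' x.
Proof. by move=> WW' x [e [We <-]]; exists e; split; first exact: WW'. Qed.

Lemma img_sub_sheet (i : I) (W : E -> Prop) :
  (forall e, W e -> S i e) -> img (on_sheet W i) = img W.
Proof.
move=> WS; apply: pred_ext => x; split; first by apply: img_mono => e [].
by apply: img_mono => e We; split=> //; exact: WS.
Qed.

Lemma op_img_sheet (i : I) : op (img (S i)).
Proof. by rewrite -(@img_sub_sheet i (S i)) //; exact: sheet_overlap. Qed.

(** By injectivity of [rho] on [S i], the part of [W] in sheet [j] has as image the intersection of
    [img W] with the image of the overlap of the two sheets. *)
Lemma op_sub_sheet (i : I) (W : E -> Prop) :
  (forall e, W e -> S i e) -> op (img W) -> op (W : sheet_stream -> Prop).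
Proof.
move=> WS oW j; case: streamX => [[_ [_ opI]] _].
rewrite (_ : img _ = fun x => img W x /\ img (on_sheet (S i) j) x).
  exact: opI oW (sheet_overlap i j).
apply: pred_ext => x; split.
  move=> [e [[We Se] <-]]; split; exists e; split=> //.
  by split=> //; exact: WS.
move=> [[e [We <-]] [e' [[Sie' Sje'] ee']]].
have ee := rho_inj Sie' (WS _ We) ee'.
by exists e'; do 2!split=> //; rewrite ee.
Qed.

Lemma op_sheet (i : I) : op (S i : sheet_stream -> Prop).
Proof. by move=> j; exact: sheet_overlap. Qed.

Lemma sheet_topology : is_topology (@op sheet_stream).
Proof.
case: (streamX) => [[opT [opU opI]] _]; split; [|split].
- move=> i; rewrite (_ : img _ = img (S i)); first exact: op_img_sheet.
  by apply: pred_ext => x; split; apply: img_mono => e // [].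
- move=> O OV i.
  rewrite (_ : img _ =
    fun x => exists V, (exists W, O W /\ V = img (on_sheet W i)) /\ V x).
    by apply: opU => V [W [OW ->]]; exact: OV.
  apply: pred_ext => x; split.
    move=> [e [[[W [OW We]] Se] <-]]; exists (img (on_sheet W i)).
    by split; [exists W|exists e].
  move=> [_ [[W [OW ->]] [e [[We Se] <-]]]]; exists e; do 2!split=> //.
  by exists W.
- move=> U V oU oV i.
  rewrite (_ : img _ = fun x => img (on_sheet U i) x /\ img (on_sheet V i) x).
    exact: opI (oU i) (oV i).
  apply: pred_ext => x; split.
    by move=> [e [[[Ue Ve] Se] <-]]; split; exists e.
  move=> [[e [[Ue Se] <-]] [e' [[Ve' Se'] ee']]].
  by exists e; do 3!split=> //; rewrite -(rho_inj Se' Se ee').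
Qed.

Lemma sheet_link_mono (V W : sheet_stream -> Prop) (a b : E) :
  op V -> op W -> (forall e, V e -> W e) -> sheet_link V a b -> sheet_link W a b.
Proof.
move=> oV oW VW [i [[Va Sa] [Vb Sb] ab]]; exists i; split.
- by split=> //; exact: VW.
- by split=> //; exact: VW.
- apply: (le_mono streamX (oV i) (oW i)) ab => //.
  by apply: img_mono => e [Ve Se]; split=> //; exact: VW.
Qed.

Lemma sheet_circulation : is_circulation (@op sheet_stream) (@le sheet_stream).
Proof.
split=> [V oV|O U OV covU].
  split; [|split].
  - move=> x y; elim=> [a b [i [[Va _] [Vb _] _]]|a b c _ [Va _] _ [_ Vc]] //.
  - move=> x Vx; case: (sheet_cover x) => i Sx; apply: t_step; exists i.
    by split=> //; apply: le_refl => //; exists x.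
  - by move=> x y z; exact: t_trans.
have oU : op (U : sheet_stream -> Prop).
  rewrite (pred_ext covU); case: sheet_topology => _ [opU _]; exact: opU.
move=> x y; rewrite /=; split; last first.
  apply: clos_trans_sub => a b [V [OV']].
  apply: clos_trans_sub => {}a {}b ab; apply: t_step.
  apply: (@sheet_link_mono V) => //; first exact: OV.
  by move=> e Ve; apply/covU; exists V.
apply: clos_trans_sub => {x y} a b [i [[Ua Sa] [Ub Sb]]].
case: (streamX) => [_ [_ cov]].
(* The images of the parts of members of [O] in sheet [i] cover the image of the part of [U], so the
   circulation of [X] cuts the step into a chain of steps inside single images. *)
pose Oi A := exists V, O V /\ A = img (on_sheet V i).
have opOi A : Oi A -> op A by move=> [V [OV' ->]]; exact: OV.
have covOi x : img (on_sheet U i) x <-> exists A, Oi A /\ A x.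
  split.
    move=> [e [[/covU [V [OV' Ve]] Se] <-]].
    by exists (img (on_sheet V i)); split; [exists V|exists e].
  move=> [_ [[V [OV' ->]] [e [[Ve Se] <-]]]]; exists e; do 2!split=> //.
  by apply/covU; exists V.
move=> /(cov _ _ opOi covOi).
(* The chain lives in [X], but its points lift uniquely to [S i]. Carrying the existence of lifts
   lets the induction join two chains at the lift of their common point. *)
suff lift p q : clos_trans X (fun p q => exists A, Oi A /\ le A p q) p q ->
    (exists e, S i e /\ rho e = p) /\ (exists e, S i e /\ rho e = q) /\
    forall e e', S i e -> S i e' -> rho e = p -> rho e' = q ->
      clos_trans E (fun a b => exists V, O V /\ clos_trans E (sheet_link V) a b) e e'.
  by move=> /lift [_ [_ H]]; exact: H.
elim=> {p q} [p q [_ [[V [OV' ->]] pq]]|p q r _ [Hp [_ IH1]] _ [[e [Se eq]] [Hr IH2]]].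
  have [[e [[Ve Se] ep]] [e' [[Ve' Se'] eq]]] := le_mem streamX (OV V OV' i) pq.
  split; [by exists e|split; [by exists e'|]].
  move=> f f' Sf Sf' fp fq; apply: t_step; exists V; split=> //.
  rewrite -(rho_inj Se Sf) ?ep // -(rho_inj Se' Sf') ?eq //.
  by apply: t_step; exists i; split=> //; rewrite ep eq.
split=> //; split=> // f f' Sf Sf' fp fr.
by apply: (t_trans _ _ _ e); [exact: IH1|exact: IH2].
Qed.

Lemma sheet_is_stream : is_stream sheet_stream.
Proof. by split; [exact: sheet_topology|exact: sheet_circulation]. Qed.

Lemma rho_continuous : continuous (rho : sheet_stream -> X).
Proof.
move=> V oV i; case: streamX => [[_ [_ opI]] _].
rewrite (_ : img _ = fun x => V x /\ img (S i) x).
  exact: opI oV (op_img_sheet i).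
apply: pred_ext => x; split.
  by move=> [e [[Ve Se] <-]]; split=> //; exists e.
by move=> [Vx [e [Se ex]]]; exists e; do 2!split=> //; rewrite ex.
Qed.

Lemma rho_le (W : sheet_stream -> Prop) (V : X -> Prop) (a b : E) :
  op W -> op V -> (forall e, W e -> V (rho e)) ->
  le W a b -> le V (rho a) (rho b).
Proof.
move=> oW oV WV; elim=> [x y [i [_ _ xy]]|x y z _ xy _ yz].
  by apply: (le_mono streamX (oW i)) xy => // _ [e [[We _] <-]]; exact: WV.
exact: le_trans xy yz.
Qed.

Lemma rho_stream_map : stream_map (rho : sheet_stream -> X).
Proof.
split=> [|V oV x y]; first exact: rho_continuous.
by apply: rho_le => //; exact: rho_continuous.
Qed.

(** [V] is tied to the image by an equation because one open set serves all the sheets over it. The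
    inverse is the section of [rho] with values in [S i]. *)
Lemma sheet_iso (i : I) (V : X -> Prop) : V = img (S i) ->
  exists r : substream (S i : sheet_stream -> Prop) -> substream V,
    (forall x, proj1_sig (r x) = rho (proj1_sig x)) /\ stream_iso r.
Proof.
move=> ->.
have im e : S i e -> img (S i) (rho e) by move=> Se; exists e.
pose r (x : substream (S i : sheet_stream -> Prop)) : substream (img (S i)) :=
  exist _ (rho (proj1_sig x)) (im _ (proj2_sig x)).
have sec (v : substream (img (S i))) : {e | S i e /\ rho e = proj1_sig v}.
  by apply: constructive_indefinite_description; case: v.
pose g (v : substream (img (S i))) : substream (S i : sheet_stream -> Prop) :=
  exist _ (proj1_sig (sec v)) (proj1 (proj2_sig (sec v))).
have gE v : rho (proj1_sig (g v)) = proj1_sig v by rewrite /=; case: (sec v) => e [].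
have rg v : r (g v) = v by apply: sig_ext; rewrite /= gE.
have gr x : g (r x) = x.
  apply: sig_ext; apply: (rho_inj (proj2_sig (g (r x))) (proj2_sig x)).
  by rewrite gE.
have r_cont : continuous r.
  move=> A oA; apply: (@op_sub_sheet i); first by move=> e [].
  rewrite (_ : img _ = sub_img A) //; apply: pred_ext => x; split.
    by move=> [e [[h Ae] <-]]; exists (im e h).
  move=> [h Ax]; exists (proj1_sig (g (exist _ x h))); split; last by rewrite gE.
  exists (proj2_sig (g (exist _ x h))).
  by rewrite (_ : exist _ _ _ = g (exist _ x h)) ?rg //; exact: sig_ext.
have subS (A : substream (S i : sheet_stream -> Prop) -> Prop) e :
    sub_img A e -> S i e by case.
(* Pulling a set back along [g] amounts to taking its image under [rho], so continuity of [g] is the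
   openness condition of [sheet_stream] at [i]. *)
have gA (A : substream (S i : sheet_stream -> Prop) -> Prop) :
    sub_img (fun v => A (g v)) = img (sub_img A).
  apply: pred_ext => x; split.
    move=> [h Ax]; exists (proj1_sig (g (exist _ x h))); split; last by rewrite gE.
    exists (proj2_sig (g (exist _ x h))).
    by rewrite (_ : exist _ _ _ = g (exist _ x h)) //; exact: sig_ext.
  move=> [e [[h Ae] <-]]; exists (im e h).
  by rewrite (_ : g _ = exist _ e h) //; rewrite -[RHS]gr; congr g; exact: sig_ext.
exists r; split=> //; split; first split=> //.
  move=> A oA x y; apply: rho_le => //; first exact: r_cont.
  by move=> e [h Ae]; exists (im e h).
exists g; split=> //; split.
  move=> A oA; rewrite /op /= gA -(@img_sub_sheet i); last exact: subS.
  exact: (oA i).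
move=> A oA x y.
rewrite /le /= gA => xy.
have oAi : op (img (sub_img A)).
  by rewrite -(@img_sub_sheet i); [exact: (oA i)|exact: subS].
have [] := le_mem streamX oAi xy.
move=> [e [Ae ex]] [e' [Ae' ey]].
have xe : proj1_sig (g x) = e.
  by apply: (rho_inj (proj2_sig (g x))) => //; [exact: (subS A)|rewrite gE].
have ye : proj1_sig (g y) = e'.
  by apply: (rho_inj (proj2_sig (g y))) => //; [exact: (subS A)|rewrite gE].
rewrite [X in clos_trans _ _ X _]xe [X in clos_trans _ _ _ X]ye.
apply: t_step; exists i; split; [by split=> //; exact: (subS A)..|].
by rewrite ex ey img_sub_sheet //; exact: subS.
Qed.

End Sheets.

(** * Coordinate sums *)

Local Open Scope R_scope.

HB.instance Definition _ := Monoid.isComLaw.Build R 0 Rplus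
  (fun x y z => esym (Rplus_assoc x y z)) Rplus_comm Rplus_0_l.
HB.instance Definition _ := Monoid.isComLaw.Build R 1 Rmult
  (fun x y z => esym (Rmult_assoc x y z)) Rmult_comm Rmult_1_l.
HB.instance Definition _ := Monoid.isMulLaw.Build R 0 Rmult Rmult_0_l Rmult_0_r.
HB.instance Definition _ := Monoid.isAddLaw.Build R Rmult Rplus
  (fun x y z => Rmult_plus_distr_r x y z) (fun x y z => Rmult_plus_distr_l x y z).

Definition coord_sum (n : nat) (t : 'I_n -> R) : R := \big[Rplus/0]_i t i.

Definition indic (b : bool) : R := if b then 1 else 0.

(** [k] counts the constant coordinates 1 that the morphism inserts; this count adds up under
    composition and products. *)
Lemma box_mor_coord_sum (m n : nat) (f : ('I_m -> bool) -> ('I_n -> bool)) :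
  box_mor f -> exists k : Z, forall x,
    coord_sum (fun j => indic (f x j)) = coord_sum (fun i => indic (x i)) + IZR k.
Proof.
rewrite /coord_sum; elim=> {m n f}.
- by move=> n; exists 0%Z => x; ring.
- by exists 0%Z => x; rewrite big_ord_recl !big_ord0 /=; ring.
- by exists 1%Z => x; rewrite big_ord_recl !big_ord0 /=; ring.
- move=> l m n f g _ [k fk] _ [k' gk']; exists (k + k')%Z => x.
  by rewrite gk' fk plus_IZR; ring.
- move=> a b c d f g _ [k fk] _ [k' gk']; exists (k + k')%Z => x.
  rewrite !big_split_ord /= plus_IZR.
  have -> : \big[Rplus/0]_i indic (prod_map a b c d f g x (lshift d i)) =
      \big[Rplus/0]_i indic (x (lshift c i)) + IZR k.
    rewrite -(fk (fun i => x (lshift c i))); apply: eq_bigr => i _.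
    by rewrite /prod_map (unsplitK (inl i)).
  have -> : \big[Rplus/0]_i indic (prod_map a b c d f g x (rshift b i)) =
      \big[Rplus/0]_i indic (x (rshift a i)) + IZR k'.
    rewrite -(gk' (fun i => x (rshift a i))); apply: eq_bigr => i _.
    by rewrite /prod_map (unsplitK (inr i)).
  by rewrite [LHS]Monoid.mulmACA.
- move=> m n f g _ [k fk] fg; exists k => x.
  by rewrite -fk; apply: eq_bigr => j _; rewrite fg.
Qed.

Lemma vert_weightE (m : nat) (x : {ffun 'I_m -> bool}) (t : 'I_m -> R) :
  vert_weight m x t = \big[Rmult/1]_i (if x i then t i else 1 - t i).
Proof. by rewrite /vert_weight foldrE big_map big_enum. Qed.

Lemma lin_extE (m n : nat) (f : ('I_m -> bool) -> ('I_n -> bool)) (t : 'I_m -> R) j :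
  lin_ext f t j = \big[Rplus/0]_(x : {ffun 'I_m -> bool}) (indic (f x j) * vert_weight m x t).
Proof. by rewrite /lin_ext foldrE big_map big_enum. Qed.

(** Expand the product over [i] of [t i + (1 - t i)], all of whose factors are 1. *)
Lemma sum_vert_weight (m : nat) (t : 'I_m -> R) :
  \big[Rplus/0]_(x : {ffun 'I_m -> bool}) vert_weight m x t = 1.
Proof.
under eq_bigr => x _ do rewrite vert_weightE.
rewrite -(bigA_distr_bigA (fun i (b : bool) => if b then t i else 1 - t i)).
by rewrite big1 // => i _; rewrite big_bool /=; ring.
Qed.

Lemma lin_ext_id (m : nat) (t : 'I_m -> R) (i : 'I_m) :
  lin_ext (fun x : 'I_m -> bool => x) t i = t i.
Proof.
rewrite lin_extE.
(* [F] absorbs the indicator of coordinate [i] into the weight, so that the sum over vertices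
   factors: the factor at [i] is [t i] and all others are 1. *)
pose F k (b : bool) := (if k == i then indic b else 1) * (if b then t k else 1 - t k).
transitivity (\big[Rplus/0]_(x : {ffun 'I_m -> bool}) \big[Rmult/1]_k F k (x k)).
  apply: eq_bigr => x _; rewrite vert_weightE big_split /=; congr (_ * _).
  rewrite (bigD1 i) //= eqxx big1 ?Rmult_1_r // => k /negbTE -> //.
rewrite -(bigA_distr_bigA F) (bigD1 i) //= [X in _ * X]big1.
  by rewrite big_bool /F /= eqxx; ring.
by move=> k /negbTE ki; rewrite big_bool /F /= ki; ring.
Qed.

(* Both sides are affine combinations of vertex values with the same weights. *)
Lemma coord_sum_lin_ext (m n : nat) (f : ('I_m -> bool) -> ('I_n -> bool)) :
  box_mor f -> exists k : Z, forall t,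
    coord_sum (lin_ext f t) = coord_sum t + IZR k.
Proof.
move=> /box_mor_coord_sum [k fk]; exists k => t; rewrite /coord_sum.
have sumE p (g : ('I_m -> bool) -> ('I_p -> bool)) :
    \big[Rplus/0]_j lin_ext g t j = \big[Rplus/0]_(x : {ffun 'I_m -> bool})
      (coord_sum (fun j => indic (g x j)) * vert_weight m x t).
  under eq_bigr => j _ do rewrite lin_extE.
  rewrite exchange_big /=; apply: eq_bigr => x _.
  by rewrite /coord_sum big_distrl.
transitivity (\big[Rplus/0]_(x : {ffun 'I_m -> bool})
    (coord_sum (fun i => indic (x i)) * vert_weight m x t + IZR k * vert_weight m x t)).
  by rewrite sumE; apply: eq_bigr => x _; rewrite -Rmult_plus_distr_r -(fk x).
rewrite big_split /= -(sumE m (fun x => x)) -big_distrr /= sum_vert_weight Rmult_1_r.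
by congr (_ + _); apply: eq_bigr => i _; rewrite lin_ext_id.
Qed.

(** * Monotonicity and continuity of coordinate sums *)

Lemma coord_sum_le (n : nat) (t u : 'I_n -> R) :
  (forall i, t i <= u i) -> coord_sum t <= coord_sum u.
Proof.
move=> tu; rewrite /coord_sum.
by elim/big_ind2: _ => [|x y z w ? ?|i _]; [lra|lra|exact: tu].
Qed.

(** The equality case of monotonicity, and the source of strictness: a directed step in a cube that
    does not raise the sum is constant. *)
Lemma coord_sum_eq (n : nat) (t u : 'I_n -> R) :
  (forall i, t i <= u i) -> coord_sum u <= coord_sum t -> forall i, t i = u i.
Proof.
move=> tu; rewrite /coord_sum => ut i; move: ut.
rewrite (bigD1 i) //= [X in _ <= X](bigD1 i) //=.
have : \big[Rplus/0]_(j | j != i) t j <= \big[Rplus/0]_(j | j != i) u j.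
  by elim/big_ind2: _ => [|x y z w ? ?|j _]; [lra|lra|exact: tu].
have aux (a b c d : R) : a <= b -> c <= d -> b + d <= a + c -> a = b by lra.
exact: aux (tu i).
Qed.

Lemma coord_sum_dist (n : nat) (t u : 'I_n -> R) (e : R) :
  (forall i, Rabs (u i - t i) <= e) -> Rabs (coord_sum u - coord_sum t) <= INR n * e.
Proof.
rewrite /coord_sum; elim: n t u => [|n IH] t u tu.
  by rewrite !big_ord0 /= Rminus_diag Rabs_R0; lra.
rewrite !big_ord_recl S_INR.
have := IH (fun i => t (lift ord0 i)) (fun i => u (lift ord0 i)) (fun i => tu _).
(* For [p = INR n * e], the bound given by induction, the last summand vanishes. *)
have aux (a b c d p : R) : Rabs (b - a) <= e -> Rabs (d - c) <= p ->
    Rabs (b + d - (a + c)) <= (INR n + 1) * e + (p - INR n * e).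
  have := Rabs_triang (b - a) (d - c).
  by rewrite (_ : b - a + (d - c) = b + d - (a + c)); [lra|ring].
by move=> /(aux _ _ _ _ _ (tu ord0)); rewrite Rminus_diag Rplus_0_r.
Qed.

Lemma coord_sum_open (n : nat) (a b : R) :
  cube_open n (fun t => a < coord_sum (proj1_sig t) < b).
Proof.
move=> t [ta tb]; set s := coord_sum (proj1_sig t) in ta tb *.
pose d := Rmin (s - a) (b - s).
have d0 : 0 < d by apply: Rmin_pos; lra.
have n0 : 0 < INR n + 1 by move: (pos_INR n) => *; lra.
(* Dividing by [n + 1] keeps the denominator positive for [n = 0] and puts the total deviation
   strictly below [d]. *)
exists (d / (INR n + 1)); split=> [|u tu]; first exact: Rdiv_lt_0_compat.
have := @coord_sum_dist n (proj1_sig t) (proj1_sig u) (d / (INR n + 1))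
  (fun i => Rlt_le _ _ (tu i)).
have : INR n * (d / (INR n + 1)) < d.
  have -> : INR n * (d / (INR n + 1)) = d - d / (INR n + 1) by field; lra.
  by have := Rdiv_lt_0_compat _ _ d0 n0; lra.
have := Rmin_l (s - a) (b - s); have := Rmin_r (s - a) (b - s); rewrite -/d -/s => ? ? ?.
move=> H; have /Rabs_def2 : Rabs (coord_sum (proj1_sig u) - s) < d by lra.
lra.
Qed.

Lemma frac_part_addz (r : R) (k : Z) : frac_part (r + IZR k) = frac_part r.
Proof.
have [? ?] := base_fp r.
have [] := @Int_part_frac_part_spec (r + IZR k) (Int_part r + k) (frac_part r).
- lra.
- by rewrite plus_IZR /frac_part; ring.
- by move=> _ ->.
Qed.

(** * The covering of a stream realization *)

Section Realization.

Variables (B : PCSet) (X : Stream).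
Variable C : forall n, (cube_car n -> Prop) -> cube_car n -> cube_car n -> Prop.
Variable iota : forall n, cell B n -> cube n (@C n) -> X.
Hypothesis real : is_stream_realization B X C iota.

Lemma realization_is_stream : is_stream X.
Proof. by case: real => _ []. Qed.

Lemma cube_is_stream (n : nat) : is_stream (cube n (@C n)).
Proof. by case: real => /(_ n) []. Qed.

Lemma iota_stream_map (n : nat) (x : cell B n) : stream_map (@iota n x).
Proof. by case: real => _ [_ [+ _]]; apply. Qed.

(** Enlarge [V] to the whole cube, the preimage of the whole interval, and use that each projection
    is a stream map. *)
Lemma cube_le_coord (n : nat) (V : cube n (@C n) -> Prop) (t u : cube n (@C n)) :
  op V -> le V t u -> forall i, proj1_sig t i <= proj1_sig u i.
Proof.
move=> oV tu i; case: real => /(_ n) [_ [projS _]] _.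
have opT : op (fun _ : cube n (@C n) => True) by case: (cube_is_stream n) => [[]].
have oT : op (fun _ : dI => True) by case: (projS i) => _ _ x _; exists 1; split=> //; lra.
case: (projS i) => _ /(_ _ oT t u) [] //.
exact: (le_mono (cube_is_stream n) oV opT) tu.
Qed.

(** The first disjunct makes the closure reflexive on [V] without knowing that the cells cover
    [X]. *)
Definition cell_link (V : X -> Prop) (a b : X) : Prop :=
  (a = b /\ V a) \/
  exists n (x : cell B n) (t u : cube n (@C n)),
    [/\ iota x t = a, iota x u = b & le (fun z => V (iota x z)) t u].

(** The final topology and circulation for the maps [iota], put on the carrier of [X] itself so that
    the identity can be compared with mediating maps. *)
Definition final_stream : Stream :=
  {| car := X;
     op := fun V => forall n (x : cell B n), cube_open n (fun t => V (iota x t));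
     le := fun V => clos_trans X (cell_link V) |}.

Lemma cell_link_mem (V : final_stream -> Prop) (a b : X) :
  op V -> cell_link V a b -> V a /\ V b.
Proof.
move=> oV [[<- Va]|[n [x [t [u [<- <- tu]]]]]] //.
exact: (le_mem (cube_is_stream n) (oV n x) tu).
Qed.

Lemma final_is_stream : is_stream final_stream.
Proof.
have topF : is_topology (@op final_stream).
  split; [|split].
  - by move=> n x; case: (cube_is_stream n) => [[]].
  - move=> O OV n x t [V [OV' Vt]].
    have [e [e0 eV]] := OV V OV' n x t Vt.
    by exists e; split=> // u tu; exists V; split=> //; exact: eV.
  - move=> U V oU oV n x; case: (cube_is_stream n) => [[_ [_ opI]] _].
    exact: opI (oU n x) (oV n x).
split=> //; split=> [V oV|O U OV covU].
  split; [|split].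
  - move=> a b; elim=> [x y /(cell_link_mem oV)|x y z _ [Vx _] _ [_ Vz]] //.
  - by move=> a Va; apply: t_step; left.
  - by move=> a b c; exact: t_trans.
have oU : op (U : final_stream -> Prop).
  by rewrite (pred_ext covU); case: topF => _ [opU _]; exact: opU.
have VU V : O V -> forall a, V a -> U a by move=> OV' a Va; apply/covU; exists V.
move=> a b /=; split; last first.
  apply: clos_trans_sub => {}a {}b [V [OV']].
  apply: clos_trans_sub => {}a {}b [[ab Va]|[n [x [t [u [ta ub tu]]]]]]; apply: t_step.
    by left; split=> //; exact: VU Va.
  right; exists n, x, t, u; split=> //.
  apply: (le_mono (cube_is_stream n) (OV V OV' n x) (oU n x)) tu => z.
  exact: VU.
apply: clos_trans_sub => {}a {}b [[<- /covU [V [OV' Va]]]|[n [x [t [u [<- <- tu]]]]]].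
  by apply: t_step; exists V; split=> //; apply: t_step; left.
case: (cube_is_stream n) => [_ [_ cov]].
(* The circulation of the cube splits the step along the preimages of the members of [O]; the
   resulting chain is then pushed forward along [iota x]. *)
pose Ox W := exists V, O V /\ W = fun z => V (iota x z).
have opOx W : Ox W -> cube_open n W by move=> [V [OV' ->]]; exact: OV.
have covOx z : U (iota x z) <-> exists W, Ox W /\ W z.
  split=> [/covU [V [OV' Vz]]|[_ [[V [OV' ->]] Vz]]]; last exact: VU Vz.
  by exists (fun z => V (iota x z)); split=> //; exists V.
move: tu => /(cov _ _ opOx covOx).
apply: clos_trans_map => {}t {}u [_ [[V [OV' ->]] tu]].
apply: t_step; exists V; split=> //; apply: t_step; right.
by exists n, x, t, u.
Qed.

(* The identity of [X] is a stream map to and from [final_stream]: it is one of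
   the mediating maps of the universal property, and these are unique. *)
Lemma realization_final (V : X -> Prop) :
  (forall n (x : cell B n), cube_open n (fun t => V (iota x t))) ->
  op V /\ forall a b, le V a b -> clos_trans X (cell_link V) a b.
Proof.
move=> oV; case: real => _ [sX [iotaS [compat univ]]].
have oF (W : X -> Prop) : op W -> op (W : final_stream -> Prop).
  by move=> oW n x; case: (iotaS n x) => + _; apply.
have idS : stream_map (fun a : final_stream => (a : X)).
  split=> [//|W oW a b]; elim=> [x y|x y z _ xy _ yz]; last exact: le_trans xy yz.
  move=> [[-> Wx]|[n [c [t [u [<- <- tu]]]]]]; first exact: le_refl.
  by case: (iotaS n c) => _; apply.
have iotaF n x : stream_map (fun t => iota x t : final_stream) (X := cube n (@C n)).
  split=> [W oW|W oW t u tu]; first exact: oW.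
  by apply: t_step; right; exists n, x, t, u.
have [h [[hc hle] [hiota _]]] := univ _ final_is_stream _ iotaF compat.
have [h0 [_ [_ uniq0]]] := univ _ sX _ iotaS compat.
have hid a : h a = a.
  transitivity (h0 a); last by symmetry; apply: (uniq0 (fun a => a)); first by split.
  apply: (uniq0 (fun a => h a : X)) => //.
  split=> [W oW|W oW x y xy]; first by apply: hc; exact: oF.
  by case: idS => _; apply=> //; apply: hle => //; exact: oF.
have hE : (fun z => V (h z)) = V by apply: pred_ext => z; rewrite hid.
split=> [|a b ab]; first by rewrite -hE; exact: hc.
by have := hle V oV a b; rewrite hE !hid; exact.
Qed.

(** The indiscrete target leaves only compatibility with faces to check, where the two coordinate
    sums differ by an integer. *)
Lemma coord_sum_mod1 : exists s : X -> R, forall n (x : cell B n) t,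
  s (iota x t) = frac_part (coord_sum (proj1_sig t)).
Proof.
case: real => _ [_ [_ [_ univ]]].
pose g n (x : cell B n) (t : cube n (@C n)) : indiscrete_stream R :=
  frac_part (coord_sum (proj1_sig t)).
have [||h [_ [hg _]]] := univ _ (indiscrete_is_stream R) g; last by exists h.
  move=> n x.
  have gc : continuous (@g n x).
    move=> V [fV|eV] t Vt; last by case: (eV _ Vt).
    by exists 1; split=> //; lra.
  split=> // V oV t u tu.
  exact: (le_mem (cube_is_stream n) (gc V oV) tu).
move=> m n f boxf x t u tu; have [k fk] := coord_sum_lin_ext boxf.
rewrite /g (_ : proj1_sig u = lin_ext f (proj1_sig t)) ?fk ?frac_part_addz //.
exact: functional_extensionality.
Qed.

End Realization.

(** The integers differ by less than 1. This separates the sheets over an arc and makes [fst]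
    injective on each of them. *)
Lemma integer_in_unit_interval (k l : Z) (a b c : R) :
  c < a + IZR k < c + 1 -> c < b + IZR l < c + 1 -> a = b -> k = l.
Proof.
move=> [? ?] [? ?] ab; have k1 : IZR k < IZR (l + 1) by rewrite plus_IZR; lra.
have l1 : IZR l < IZR (k + 1) by rewrite plus_IZR; lra.
by move: k1 l1 => /lt_IZR ? /lt_IZR ?; lia.
Qed.


(** * The pullback of the universal cover of the circle *)

Section Covering.

Variables (B : PCSet) (X : Stream).
Variable C : forall n, (cube_car n -> Prop) -> cube_car n -> cube_car n -> Prop.
Variable iota : forall n, cell B n -> cube n (@C n) -> X.
Hypothesis real : is_stream_realization B X C iota.
Variable s : X -> R.
Hypothesis s_iota : forall n (x : cell B n) t,
  s (iota x t) = frac_part (coord_sum (proj1_sig t)).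

(* The point [(p, k)] stands for the point of the pullback over [p] with real
   coordinate [s p + k]; the sheets are the preimages of open unit intervals. *)
Definition height (e : X * Z) : R := s (fst e) + IZR (snd e).

Definition sheet (c : R) (e : X * Z) : Prop := c < height e < c + 1.

(** [s] may jump where a coordinate sum crosses an integer, but the union over [k] does not see the
    jump: in each cube it is a union of open slabs. *)
Lemma s_arc_open (a b : R) : op (fun p => exists k, a < s p + IZR k < b).
Proof.
apply: (proj1 (realization_final real _)) => n x t [k].
rewrite s_iota /frac_part; set q := Int_part _ => kab.
have [|e [e0 eV]] := @coord_sum_open n (a - IZR k + IZR q) (b - IZR k + IZR q) t; first lra.
exists e; split=> // u /eV; set r := coord_sum _ => rab.
(* Corrects [k] by the change of the integer part between [t] and [u]. *)
exists (k - q + Int_part r)%Z; rewrite s_iota /frac_part -/r plus_IZR minus_IZR.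
by lra.
Qed.

Lemma sheet_inj (c : R) (e e' : X * Z) :
  sheet c e -> sheet c e' -> fst e = fst e' -> e = e'.
Proof.
case: e e' => [p k] [p' k']; rewrite /sheet /height /= => ke ke' pp'.
by rewrite (integer_in_unit_interval ke ke') ?pp'.
Qed.

Lemma sheet_mem (e : X * Z) : exists c, sheet c e.
Proof. by exists (height e - / 2); rewrite /sheet; lra. Qed.

Lemma sheet_overlap_open (c d : R) : op (img fst (on_sheet sheet (sheet c) d)).
Proof.
rewrite (_ : img _ _ = fun p => exists k, Rmax c d < s p + IZR k < Rmin c d + 1).
  exact: s_arc_open.
apply: pred_ext => p; rewrite /on_sheet /sheet /height /Rmax /Rmin.
case: (Rle_dec c d) => cd; split.
- by move=> [[p' k] /= [? <-]]; exists k; lra.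
- by move=> [k pk]; exists (p, k); split=> //=; lra.
- by move=> [[p' k] /= [? <-]]; exists k; lra.
- by move=> [k pk]; exists (p, k); split=> //=; lra.
Qed.

Definition cover_stream : Stream := sheet_stream fst sheet.

Lemma cover_is_stream : is_stream cover_stream.
Proof.
exact: (sheet_is_stream (realization_is_stream real) sheet_inj sheet_mem sheet_overlap_open).
Qed.

Lemma cover_is_covering : stream_covering (fst : cover_stream -> X).
Proof.
have sX := realization_is_stream real.
split; first exact: (rho_stream_map sX sheet_overlap_open).
split=> [b|b]; first by exists (b, 0%Z).
(* Centres the unit interval at [s b], the height of [(b, 0)]. Integer translates of [c] give sheets
   with the same image, and these are the sheets over the neighbourhood of [b]. *)
set c := s b - / 2.
have imgE i : img fst (sheet c) = img fst (sheet (c + IZR i)).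
  apply: pred_ext => p; rewrite /sheet /height; split.
    move=> [[p' k] /= [? <-]]; exists (p', (k + i)%Z); split=> //=.
    by rewrite plus_IZR; lra.
  move=> [[p' k] /= [? <-]]; exists (p', (k - i)%Z); split=> //=.
  by rewrite minus_IZR; lra.
exists (img fst (sheet c)); split; first exact: op_img_sheet sheet_overlap_open _.
split; first by exists (b, 0%Z); split=> //; rewrite /sheet /height /c /=; lra.
exists Z, (fun i => sheet (c + IZR i)); split; [|split; [|split]].
- by move=> i; exact: op_sheet sheet_overlap_open _.
- move=> i j [p k]; rewrite /sheet /height /= => ki kj.
  (* Subtracting either [i] or [j] from the common height [s p + IZR k] lands in the unit interval
     above [c], hence the signs. *)
  have : (- i)%Z = (- j)%Z.
    by apply: (@integer_in_unit_interval _ _ (s p + IZR k) (s p + IZR k) c) => //;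
      rewrite opp_IZR; lra.
  by lia.
- move=> [p k]; split=> [[[p' k'] [+ /= pp']]|[i pki]].
    rewrite /sheet /height /= pp' => ?; exists (k - k')%Z.
    by rewrite minus_IZR; lra.
  by rewrite (imgE i); exists (p, k).
- move=> i; exact: (sheet_iso sX sheet_inj sheet_overlap_open (imgE i)).
Qed.

(** A relation on [X] rather than on the cover, because the chains generating the order of [X] come
    without lifts. Existence of lifts at the end points is what makes it transitive. *)
Definition lift_increasing (c : R) (p q : X) : Prop :=
  (exists a, sheet c a /\ fst a = p) /\ (exists b, sheet c b /\ fst b = q) /\
  forall a b, sheet c a -> sheet c b -> fst a = p -> fst b = q ->
    height a < height b \/ a = b.

Lemma lift_increasing_trans (c : R) (p q r : X) :
  lift_increasing c p q -> lift_increasing c q r -> lift_increasing c p r.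
Proof.
move=> [pS [[b [Sb bq]] pq]] [_ [rS qr]]; split=> //; split=> // a d Sa Sd ap dr.
case: (pq a b Sa Sb ap bq) => [ab|->]; last exact: qr.
by case: (qr b d Sb Sd bq dr) => [bd|<-]; left; [lra|].
Qed.

(* Where the sum of coordinates lies in a fixed unit interval, it differs from
   the height on the sheet by a constant integer. *)
Lemma cube_lift_increasing (c : R) (k : Z) (n : nat) (x : cell B n)
    (t u : cube n (@C n)) :
  le (fun z : cube n (@C n) => c + IZR k < coord_sum (proj1_sig z) < c + IZR k + 1) t u ->
  lift_increasing c (iota x t) (iota x u).
Proof.
move=> tu; have cS := cube_is_stream real n.
have oW := @coord_sum_open n (c + IZR k) (c + IZR k + 1).
have [Wt Wu] := le_mem cS oW tu.
have tu_coord := cube_le_coord real oW tu.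
pose lft (z : cube n (@C n)) := (iota x z, Int_part (coord_sum (proj1_sig z)) - k)%Z.
have lft_height z : height (lft z) = coord_sum (proj1_sig z) - IZR k.
  by rewrite /height /= s_iota /frac_part minus_IZR; lra.
have lft_sheet z : c + IZR k < coord_sum (proj1_sig z) < c + IZR k + 1 -> sheet c (lft z).
  by move=> ?; rewrite /sheet lft_height; lra.
split; first by exists (lft t); split; [exact: lft_sheet|].
split; first by exists (lft u); split; [exact: lft_sheet|].
move=> a b Sa Sb apt bqu.
rewrite (sheet_inj Sa (lft_sheet _ Wt) apt) (sheet_inj Sb (lft_sheet _ Wu) bqu).
rewrite !lft_height; have := coord_sum_le tu_coord => le_sum.
case: (Rlt_le_dec (coord_sum (proj1_sig t)) (coord_sum (proj1_sig u))) => lt_sum.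
  by left; lra.
right; congr lft; apply: sig_ext; apply: functional_extensionality.
exact: coord_sum_eq.
Qed.

(** The image of the sheet pulls back in a cube to the union of the slabs where the coordinate sum
    lies strictly between [c + k] and [c + k + 1]. The circulation axiom cuts a directed step into
    steps inside single slabs, where [cube_lift_increasing] applies. *)
Lemma cell_link_lift_increasing (c : R) (p q : X) :
  cell_link iota (img fst (sheet c)) p q -> lift_increasing c p q.
Proof.
move=> [[<- pS]|[n [x [t [u [<- <- ]]]]]].
  split=> //; split=> // a b Sa Sb ap bp; right.
  by apply: (sheet_inj Sa Sb); rewrite ap bp.
case: (cube_is_stream real n) => [_ [_ cov]].
pose Oc W := exists k : Z, W = fun z : cube n (@C n) =>
  c + IZR k < coord_sum (proj1_sig z) < c + IZR k + 1.
have opOc W : Oc W -> cube_open n W by move=> [k ->]; exact: coord_sum_open.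
have covOc z : img fst (sheet c) (iota x z) <-> exists W, Oc W /\ W z.
  split.
    move=> [[p' k] [+ /= pz]]; rewrite /sheet /height /= pz s_iota /frac_part => ?.
    pose k' := (Int_part (coord_sum (proj1_sig z)) - k)%Z.
    eexists; split; first by exists k'.
    by rewrite /k' minus_IZR; lra.
  move=> [_ [[k ->] zk]].
  exists (iota x z, Int_part (coord_sum (proj1_sig z)) - k)%Z; split=> //.
  by rewrite /sheet /height /= s_iota /frac_part minus_IZR; lra.
move=> /(cov _ _ opOc covOc).
elim=> [t' u' [_ [[k ->]]]|t' z u' _ IH1 _ IH2]; first exact: cube_lift_increasing.
exact: lift_increasing_trans IH1 IH2.
Qed.

(** A generating step stays in one sheet and is directed over the image of that sheet;
    [realization_final] refines it there into cell links, each of which raises the height or is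
    constant. *)
Lemma height_increasing (a b : cover_stream) :
  le_full a b -> height a < height b \/ a = b.
Proof.
elim=> {a b} [a b [c]|a b d _ ab _ bd]; last first.
  by case: ab bd => [ab|->] // [bd|<-]; left; [lra|].
rewrite (_ : on_sheet _ _ c = sheet c); last by apply: pred_ext => e; split=> [[]|].
move=> [Sa Sb ab].
have [|_ /(_ _ _ ab)] := realization_final real (V := img fst (sheet c)).
  move=> n x; case: (iota_stream_map real x) => + _; apply.
  exact: op_img_sheet sheet_overlap_open _.
move=> chain; suff [_ [_]] : lift_increasing c (fst a) (fst b) by apply.
elim: chain => [p q|p q r _ IH1 _ IH2]; first exact: cell_link_lift_increasing.
exact: lift_increasing_trans IH1 IH2.
Qed.

End Covering.

Local Close Scope R_scope.

Theorem mainTheorem1 :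
  forall (B : PCSet), is_precubical B ->
  forall (R : Stream)
    (C : forall n, (cube_car n -> Prop) -> cube_car n -> cube_car n -> Prop)
    (iota : forall n, cell B n -> cube n (C n) -> R),
  is_stream_realization B R C iota ->
  exists (E : Stream) (rho : E -> R),
    is_stream E /\ stream_covering rho /\
    (forall x y : E, le_full x y -> le_full y x -> x = y).
Proof.
move=> B _ X C iota real; have [s s_iota] := coord_sum_mod1 real.
exists (cover_stream s), fst; split; [|split].
- exact: (cover_is_stream real s_iota).
- exact: (cover_is_covering real s_iota).
- move=> a b ab ba; case: (height_increasing real s_iota ab) => // ab_lt.
  by case: (height_increasing real s_iota ba) => // ba_lt; lra.
Qed.
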